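(* For every $n$, the map $\Phi_B$ is a bijection from $\mathcal{PT}_B(n)$ to $SP_{2n}$, the set of permutations $\pi$ of $\{1,\dots,2n\}$ satisfying $\pi_i+\pi_{2n+1-i}=2n+1$ for all $i$.
   Context: Let $F$ be a Ferrers diagram (left-justified rows of weakly decreasing lengths), empty rows and empty columns allowed, with $k$ columns and length $n$ = number of rows plus columns. The shifted diagram $\bar F$ is obtained by adding on top of $F$ $k$ new left-justified rows of lengths $1,\dots,k$ (top to bottom); the rightmost cells of the added rows are the diagonal cells. A type $B$ permutation tableau of length $n$ is a $0,1$-filling of such $\bar F$ such that (1) each column contains a $1$; (2) no $0$ has both a $1$ above it in its column and a $1$ to its left in its row; (3) a $0$ in a diagonal cell has no $1$ to its left in its row. $\mathcal{PT}_B(n)$ is the set of these. The symmetric tableau $T_s$ of $T$ is obtained by adjoining to $T$, for each non-diagonal cell, its mirror image with respect to the diagonal line (through the diagonal cells, running north-west to south-east), filled with the same entry; it is a filled Ferrers diagram of length $2n$. Label the $2n$ south-east boundary steps of $T_s$ by $1,\dots,2n$ from north-east to south-west; a row is labeled $i$ if its right-end vertical boundary step is labeled $i$, a column is labeled $j$ if its bottom horizontal boundary step is labeled $j$. For a label $i$, the zigzag path $P_i$ enters from the left of row $i$ (travelling east) or the top of column $i$ (travelling south) and moves east/south through cells, switching direction each time it meets a cell containing $1$, until it exits through a boundary step. $\Phi_B(T)$ is the permutation $\pi$ of $\{1,\dots,2n\}$ with $\pi_i$ the label of the boundary step of $T_s$ through which $P_i$ exits. *)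

(* Defs.v *)
From mathcomp Require Import all_boot all_fingroup.

Set Implicit Arguments.
Unset Strict Implicit.
Unset Printing Implicit Defensive.

(* Rows and columns are numbered from 0, rows from top to bottom, columns     *)
(* from left to right; the labels of boundary steps are numbered from 1.      *)
(* [filling T] lists the rows of the filled shifted diagram from top to       *)
(* bottom, [true] standing for the entry 1.                                   *)
Record tableau := Tableau {
  ncols : nat;
  frows : seq nat;
  filling : seq bitseq
}.

Definition is_ferrers (k : nat) (lam : seq nat) : bool :=
  sorted geq lam && all (fun l => l <= k) lam.

Definition tlength (T : tableau) : nat := size (frows T) + ncols T.

Definition shifted_shape (T : tableau) : seq nat :=
  iota 1 (ncols T) ++ frows T.

Definition in_shifted (T : tableau) (r c : nat) : bool :=
  c < nth 0 (shifted_shape T) r.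

(* false outside the diagram *)
Definition one (T : tableau) (r c : nat) : bool :=
  nth false (nth [::] (filling T) r) c.

Definition zero (T : tableau) (r c : nat) : bool :=
  in_shifted T r c && ~~ one T r c.

Definition one_above (T : tableau) (r c : nat) : bool :=
  [exists r' : 'I_r, one T r' c].

Definition one_left (T : tableau) (r c : nat) : bool :=
  [exists c' : 'I_c, one T r c'].

(* Row [r < ncols T] is an added row, of length [r.+1]: the diagonal cells    *)
(* are the cells [(r, r)] with [r < ncols T].                                 *)
Definition is_PTB (n : nat) (T : tableau) : bool :=
  [&& is_ferrers (ncols T) (frows T),
      tlength T == n,
      shape (filling T) == shifted_shape T,
      [forall c : 'I_(ncols T), [exists r : 'I_n, one T r c]],
      [forall r : 'I_n, forall c : 'I_(ncols T),
        zero T r c ==> ~~ (one_above T r c && one_left T r c)] &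
      [forall r : 'I_(ncols T), zero T r r ==> ~~ one_left T r r]].

Definition PTB (n : nat) : Type := {T : tableau | is_PTB n T}.

(* The symmetric tableau T_s has [tlength T] rows and as many columns, some   *)
(* possibly empty; the reflection in the diagonal line exchanges the cells    *)
(* [(r, c)] and [(c, r)].                                                     *)
Definition in_sym (T : tableau) (r c : nat) : bool :=
  in_shifted T r c || in_shifted T c r.

Definition sym_one (T : tableau) (r c : nat) : bool :=
  one T r c || one T c r.

(* Going from north-east to south-west along the boundary of T_s, the steps   *)
(* up to that of row r are those of rows 0, ..., r and those of the columns   *)
(* lying entirely to the right of the end of row r.                           *)
Definition row_label (T : tableau) (r : nat) : nat :=
  r.+1 + #|[pred c : 'I_(tlength T) | ~~ in_sym T r c]|.

(* Likewise, the steps up to that of column c are those of the columns        *)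
(* c, ..., tlength T - 1 and those of the rows that have a cell in column c.  *)
Definition col_label (T : tableau) (c : nat) : nat :=
  (tlength T - c) + #|[pred r : 'I_(tlength T) | in_sym T r c]|.

(* [travel_east T r c j]: a path moving east into position (r, c), which may  *)
(* be just outside T_s, exits through the boundary step labeled j; similarly  *)
(* for [travel_south].                                                        *)
Inductive travel_east (T : tableau) : nat -> nat -> nat -> Prop :=
| east_exit r c :
    ~~ in_sym T r c -> travel_east T r c (row_label T r)
| east_straight r c j :
    in_sym T r c -> ~~ sym_one T r c ->
    travel_east T r c.+1 j -> travel_east T r c j
| east_turn r c j :
    in_sym T r c -> sym_one T r c ->
    travel_south T r.+1 c j -> travel_east T r c j
with travel_south (T : tableau) : nat -> nat -> nat -> Prop :=
| south_exit r c :
    ~~ in_sym T r c -> travel_south T r c (col_label T c)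
| south_straight r c j :
    in_sym T r c -> ~~ sym_one T r c ->
    travel_south T r.+1 c j -> travel_south T r c j
| south_turn r c j :
    in_sym T r c -> sym_one T r c ->
    travel_east T r c.+1 j -> travel_south T r c j.

(* [zigzag T i j]: the path P_i exits through the step labeled j. *)
Inductive zigzag (T : tableau) (i j : nat) : Prop :=
| zigzag_row r :
    r < tlength T -> row_label T r = i -> travel_east T r 0 j -> zigzag T i j
| zigzag_col c :
    c < tlength T -> col_label T c = i -> travel_south T 0 c j -> zigzag T i j.

(* The label l in {1, ..., 2n} is represented by the ordinal of value l - 1;  *)
(* in particular [rev_ord] represents l |-> 2n + 1 - l.                       *)
Definition is_SP (n : nat) (p : 'S_(2 * n)) : bool :=
  [forall i : 'I_(2 * n), (p i).+1 + (p (rev_ord i)).+1 == 2 * n + 1].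

Definition SP (n : nat) : Type := {p : 'S_(2 * n) | is_SP p}.

(* Phi is the map Phi_B: on every tableau, it has the graph of i |-> exit of  *)
(* P_i. There is at most one such map, and its existence expresses that the   *)
(* exit labels form a permutation belonging to SP n.                          *)
Definition is_PhiB (n : nat) (Phi : PTB n -> SP n) : Prop :=
  forall (T : PTB n) (i : 'I_(2 * n)) (j : nat),
    zigzag (sval T) i.+1 j <-> j = (sval (Phi T) i).+1.

(* Main.v *)
(* A 1 acts on paths as a turn and a 0 as a crossing, so adding a corner cell  *)
(* in row a and column b to a diagram leaves the exit steps unchanged if it    *)
(* contains 0 and exchanges the exits a and b if it contains 1. In the         *)
(* symmetric tableau, conditions (2) and (3) say that no 0 has both a 1 above  *)
(* and a 1 to its left; hence a corner contains 0 exactly when its row or its  *)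
(* column is empty, that is, when the exit map fixes a or b. So the corners    *)
(* can be stripped one by one from the exit map alone, and on a given diagram  *)
(* the fillings correspond bijectively to the permutations of the steps that   *)
(* send no row to an earlier step and no column to a later one. The labels of  *)
(* the rows are in turn read off the permutation p of labels: they are the i   *)
(* with i < p i, and the fixed points i > n, since condition (1) places the    *)
(* empty rows beyond the Durfee square. Uniqueness makes symmetric             *)
(* permutations correspond to symmetric fillings.                              *)

(* The corner induction is [ferrers_ind], and its geometric input is [exit_del]: deleting a corner
   leaves the exit map unchanged or composes it with a transposition. [corner_filling] recovers the
   corner entry from the exit map, which gives injectivity on a fixed diagram ([le_filling_inj]).
   For existence ([le_filling_surj]) the same rule prescribes the corner entry from the desired exit
   map, and [reach_del] shows that what remains respects the boundary order of the smaller diagram.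

   The diagram is recovered from the permutation: [row_stepP] recognises the row labels, and a cell
   [(r, c)] is present exactly when row [r] precedes column [c] on the boundary, which by symmetry
   bounds a sum of two row labels ([symtab_shape]). Conversely, a permutation in [SP n] has [n]
   labels of row type, no two of them mirror images, and these define a symmetric diagram
   ([symtab_exists]). It remains to identify type B tableaux with the symmetric ones ([symtab_PTB],
   [is_PTB_of]), and the inductive paths with the function [trav] ([zigzagP]). *)
From HB Require Import structures.
From mathcomp Require Import all_boot all_fingroup.
From mathcomp Require Import zify.
Require Import Defs.

Set Implicit Arguments.
Unset Strict Implicit.
Unset Printing Implicit Defensive.

(* [inl r] is the boundary step ending row r, [inr c] the one below column c.  *)
Notation step := (nat + nat)%type.

Definition flip (s : step) : step :=
  match s with inl r => inr r | inr c => inl c end.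

Definition is_step n (s : step) : bool :=
  match s with inl r => r < n | inr c => c < n end.

Definition swap (a b : nat) (s : step) : step :=
  if s == inl a then inr b else if s == inr b then inl a else s.

Definition ferrers n (D : rel nat) :=
  (forall r c, D r c -> r < n /\ c < n) /\
  (forall r c r' c', r' <= r -> c' <= c -> D r c -> D r' c').

(* Condition (2) of tableaux, on the symmetric diagram: it also contains (3). *)
Definition le_filling (D f : rel nat) :=
  forall r c r' c', D r c -> r' < r -> c' < c -> f r' c -> f r c' -> f r c.

Definition corner (D : rel nat) a b := [&& D a b, ~~ D a.+1 b & ~~ D a b.+1].

Definition del (D : rel nat) a b : rel nat :=
  fun r c => D r c && ((r, c) != (a, b)).

Fixpoint trav (D f : rel nat) m (d : bool) r c : step :=
  if m is m'.+1 then
    if D r c then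
      if d (+) f r c then trav D f m' true r c.+1
      else trav D f m' false r.+1 c
    else if d then inl r else inr c
  else if d then inl r else inr c.

(* The fuel n + n suffices since each move increases r + c.                   *)
Definition exit n (D f : rel nat) (s : step) : step :=
  match s with
  | inl r => trav D f (n + n) true r 0
  | inr c => trav D f (n + n) false 0 c
  end.

(* The step t is at or after s along the boundary if s is a row, at or before *)
(* s if s is a column: the exits available to the path that starts at s.      *)
Definition reach (D : rel nat) (s t : step) : bool :=
  match s, t with
  | inl r, inl r' => r <= r'
  | inl r, inr c => D r c
  | inr c, inl r => D r c
  | inr c, inr c' => c <= c'
  end.

Definition tr (D : rel nat) : rel nat := fun r c => D c r.

(** * Boundary steps and induction on corners *)

Lemma flipK : involutive flip.
Proof. by case. Qed.

Lemma is_step_flip n s : is_step n (flip s) = is_step n s.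
Proof. by case: s. Qed.

Lemma swapK a b : involutive (swap a b).
Proof.
move=> s; rewrite /swap.
case: (s =P inl a) => [->|Ha] //=; first by rewrite eqxx.
by case: (s =P inr b) => [->|Hb] //=; do 2!case: eqP => //.
Qed.

Lemma swap_id a b s : s != inl a -> s != inr b -> swap a b s = s.
Proof. by rewrite /swap => /negPf-> /negPf->. Qed.

Lemma is_step_swap n a b s :
  a < n -> b < n -> is_step n (swap a b s) = is_step n s.
Proof.
rewrite /swap => an bn; case: eqP => [->/=|_]; first by rewrite an bn.
by case: eqP => [->/=|//]; rewrite an bn.
Qed.

Lemma ferrers_tr n D : ferrers n D -> ferrers n (tr D).
Proof.
case=> box down; split=> [r c /box[] //|r c r' c' ? ?]; exact: down.
Qed.

Lemma ferrers_del n D a b : ferrers n D -> corner D a b -> ferrers n (del D a b).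
Proof.
move=> [box down] /and3P[Dab nDa nDb]; split=> [r c /andP[/box //]|].
move=> r c r' c' rr cc /andP[Drc ne]; rewrite /del (down r c) //=.
apply: contra ne => /eqP[er ec]; subst r' c'.
have [-> //|/eqP ra] := eqVneq r a; last first.
  by case/negP: nDa; apply: (down r c) => //; lia.
have [-> //|/eqP cb] := eqVneq c b.
by case/negP: nDb; apply: (down r c) => //; lia.
Qed.

(** A cell maximising [r + c] is a corner, so any nonempty diagram can lose a cell and remain a
    Ferrers diagram. *)
Lemma ferrers_ind n (P : rel nat -> Prop) :
  (forall D, (forall r c, D r c = false) -> P D) ->
  (forall D a b, ferrers n D -> corner D a b -> P (del D a b) -> P D) ->
  forall D, ferrers n D -> P D.
Proof.
move=> P0 PS D.
have [m] := ubnP #|[pred x : 'I_n * 'I_n | D x.1 x.2]|.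
elim: m D => // m IH D leD FD.
have [[box down] sz] := (FD, leD).
case: (pickP [pred x : 'I_n * 'I_n | D x.1 x.2]) => [x0 Dx0|D0]; last first.
  apply: P0 => r c; apply/negP => Drc; have [rn cn] := box _ _ Drc.
  by move: (D0 (Ordinal rn, Ordinal cn)); rewrite /= Drc.
case: (@arg_maxnP _ x0 _ (fun x => x.1 + x.2) Dx0) => -[a b] /= Dab maxab.
have cab : corner D a b.
  apply/and3P; split=> //; apply/negP=> Dx; have [rn cn] := box _ _ Dx.
    by have /= := maxab (Ordinal rn, Ordinal cn) Dx; lia.
  by have /= := maxab (Ordinal rn, Ordinal cn) Dx; lia.
apply: (PS _ _ _ FD cab); apply: IH; last exact: ferrers_del.
rewrite -ltnS; apply: leq_trans leD; rewrite ltnS; apply: proper_card.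
apply/properP; split; first by apply/subsetP=> x /andP[].
by exists (a, b); rewrite !inE //= /del eqxx andbF.
Qed.

(** * Paths and exit maps *)

Lemma trav_ext (D f g : rel nat) m d r c :
  (forall r c, D r c -> f r c = g r c) -> trav D f m d r c = trav D g m d r c.
Proof.
by move=> fg; elim: m d r c => //= m IH d r c; case: ifP => // /fg->; rewrite !IH.
Qed.

Lemma exit_ext n (D f g : rel nat) s :
  (forall r c, D r c -> f r c = g r c) -> exit n D f s = exit n D g s.
Proof. by move=> fg; case: s => x; apply: trav_ext. Qed.

Lemma trav_shape_ext (D E f : rel nat) m d r c : D =2 E -> trav D f m d r c = trav E f m d r c.
Proof.
by move=> DE; elim: m d r c => //= m IH d r c; rewrite DE !IH.
Qed.

(** Reflection exchanges the two directions of travel; it reduces statements on columns to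
    statements on rows. *)
Lemma trav_tr D f m d r c :
  trav (tr D) (tr f) m (~~ d) c r = flip (trav D f m d r c).
Proof.
elim: m d r c => [|m IH] d r c /=; first by case: d.
rewrite {1 2}/tr; case: ifP => _; last by case: d.
by case: d (f r c) => -[] /=; rewrite -?(IH true) -?(IH false).
Qed.

Lemma exit_tr n D f s : exit n (tr D) (tr f) (flip s) = flip (exit n D f s).
Proof. by case: s => x; rewrite -trav_tr. Qed.

(* The invariant on (r, c) says that the path comes from inside the diagram,  *)
(* or from the start of its row or column; without it, the path could exit    *)
(* through row a or column b without having reached the corner.               *)
Lemma trav_del n D f a b m (d : bool) r c :
  ferrers n D -> corner D a b -> n + n <= m + r + c ->
  (forall x, if d then x < c -> del D a b r x else x < r -> del D a b x c) ->
  trav D f m d r c =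
    (if f a b then swap a b else id) (trav (del D a b) f m d r c).
Proof.
move=> FD cD; have [box' down'] := ferrers_del FD cD; have [box down] := FD.
have /and3P[Dab nDa nDb] := cD; have [an bn] := box _ _ Dab.
elim: m d r c => [|m IH] d r c mrc inv.
  case: d inv => inv /=; case: ifP => // _; rewrite swap_id //; apply/eqP=> -[e].
    by case: c mrc inv => [|c] mrc inv; [|have /box' := inv c (ltnSn _)]; lia.
  by case: r mrc inv => [|r] mrc inv; [|have /box' := inv r (ltnSn _)]; lia.
rewrite /=.
have [e|ne] := eqVneq (r, c) (a, b).
  case: e => ? ?; subst r c.
  rewrite Dab /del eqxx andbF.
  have Ta m' : trav D f m' true a b.+1 = inl a by case: m' => //= ?; rewrite (negPf nDb).
  have Tb m' : trav D f m' false a.+1 b = inr b by case: m' => //= ?; rewrite (negPf nDa).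
  by rewrite Ta Tb /swap; case: d inv => _; case: (f a b) => /=; rewrite ?eqxx.
rewrite {1}/del ne andbT; case: ifP => Drc.
  have dDrc : del D a b r c by rewrite /del Drc ne.
  case: ifP => _; apply: IH; [by rewrite addnS; lia| |by rewrite addnS; lia|].
    by move=> x; rewrite ltnS => xc; apply: down' dDrc.
  by move=> x; rewrite ltnS => xr; apply: down' dDrc.
case: d inv => inv; case: ifP => // _; rewrite swap_id //; apply/eqP=> -[e].
  subst r; case: (ltnP b c) => [/inv|cb]; first by rewrite /del eqxx andbF.
  by move: Drc; rewrite (down a b).
subst c; case: (ltnP a r) => [/inv|ra]; first by rewrite /del eqxx andbF.
by move: Drc; rewrite (down a b).
Qed.

Lemma exit_del n D f a b s : ferrers n D -> corner D a b ->
  exit n D f s = (if f a b then swap a b else id) (exit n (del D a b) f s).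
Proof.
by move=> FD cD; case: s => x; apply: trav_del FD cD _ _ => //; lia.
Qed.

Lemma exit_empty n D f s : (forall r c, D r c = false) -> exit n D f s = s.
Proof. by move=> D0; case: s => x /=; case: (n + n) => //= m; rewrite D0. Qed.

Lemma exit_inj n D f : ferrers n D -> injective (exit n D f).
Proof.
move: D; apply: ferrers_ind => [D D0 s t|D a b FD cD IH s t]; first by rewrite !exit_empty.
rewrite !(exit_del _ _ FD cD); case: ifP => _; last exact: IH.
by move/(can_inj (swapK a b)); apply: IH.
Qed.

Lemma exit_step n D f s : ferrers n D -> is_step n (exit n D f s) = is_step n s.
Proof.
move=> FD; move: D FD s; apply: ferrers_ind => [D D0 s|D a b FD cD IH s].
  by rewrite exit_empty.
rewrite (exit_del _ _ FD cD); case: ifP => _; last exact: IH.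
have /and3P[/(proj1 FD)[an bn] _ _] := cD.
by rewrite is_step_swap.
Qed.

Lemma trav_row_ge D f m d r c r' : trav D f m d r c = inl r' -> r <= r'.
Proof.
elim: m d r c => [|m IH] d r c /=; first by case: d => // -[->].
case: ifP => _; last by case: d => // -[->].
by case: ifP => _ /IH // /ltnW.
Qed.

(** A path leaving through column [c'] has met a cell of that column in row [r] or lower, unless it
    was already going south there; the second disjunct is this exception. *)
Lemma trav_row_col n D f m d r c c' : ferrers n D ->
  trav D f m d r c = inr c' -> D r c' || ~~ d && (c' == c).
Proof.
case=> box down; elim: m d r c => [|m IH] d r c /=.
  by case: d => // -[->]; rewrite eqxx orbT.
case: ifP => [Drc|_]; last by case: d => // -[->]; rewrite eqxx orbT.
case: ifP => dE /IH /orP[] //=; first by move->.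
  by move=> /(down _ _ r c' (leqnSn _) (leqnn _)) ->.
by move=> /eqP->; rewrite Drc.
Qed.

Lemma exit_reach n D f s : ferrers n D -> reach D s (exit n D f s).
Proof.
move=> FD; wlog: s D f FD / exists r, s = inl r.
  move=> W; case: s => x; first by apply: W => //; exists x.
  have := W (inl x) _ (tr f) (ferrers_tr FD) (ex_intro _ x erefl).
  by rewrite -[inl x]/(flip (inr x)) exit_tr; case: (exit n D f _).
case=> r -> /=; case E: (trav _ _ _ _ _ _) => [r'|c'].
  exact: trav_row_ge E.
by have := trav_row_col FD E; rewrite orbF.
Qed.

(** The first 1 of the row turns the path south, and it never climbs back. The boolean form allows a
    1 to be extracted from a row that is not fixed. *)
Lemma exit_row_fix n D f r : ferrers n D -> r < n ->
  (exit n D f (inl r) == inl r) = ~~ has (fun c => D r c && f r c) (iota 0 n).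
Proof.
move=> FD rn; have [box down] := FD; rewrite /exit.
apply/eqP/idP.
  suff G m c : n <= m + c -> trav D f m true r c = inl r ->
      forall c', c <= c' -> D r c' -> ~~ f r c'.
    move=> E; apply/hasPn => c' _; apply/negP => /andP[Dc].
    by apply/negP; apply: (G _ _ _ E) Dc; lia.
  elim: m c => [|m IH] c mc /=; first by move=> _ c' cc' /box; lia.
  case: ifP => [Drc|/negP nD _ c' cc' Dc']; last first.
    by case: nD; apply: down Dc'.
  case frc: (f r c) => /=; first by move/trav_row_ge; rewrite ltnn.
  move=> E c'; rewrite leq_eqVlt => /orP[/eqP<-|]; first by rewrite frc.
  by apply: IH E c'; lia.
move/hasPn=> H; elim: (n + n) 0 => // m IH c /=.
case: ifP => // Drc; case E: (f r c) => //=.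
by have [_ cn] := box _ _ Drc; have := H c; rewrite mem_iota cn Drc E => /(_ isT).
Qed.

Lemma exit_row_fixP n D f r : ferrers n D -> r < n ->
  reflect (forall c, D r c -> ~~ f r c) (exit n D f (inl r) == inl r).
Proof.
move=> FD rn; rewrite exit_row_fix //; apply: (iffP hasPn) => H c.
  by move=> Dc; have := H c; rewrite mem_iota Dc; apply; case/(proj1 FD): Dc.
by move=> _; apply/negP=> /andP[/H/negPf->].
Qed.

Lemma exit_col_fixP n D f c : ferrers n D -> c < n ->
  reflect (forall r, D r c -> ~~ f r c) (exit n D f (inr c) == inr c).
Proof.
move=> FD cn.
have -> : (exit n D f (inr c) == inr c) = (exit n (tr D) (tr f) (inl c) == inl c).
  rewrite -(inj_eq (inv_inj flipK)) -exit_tr //.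
exact: exit_row_fixP (ferrers_tr FD) cn.
Qed.

(** * Fillings of a fixed diagram and their exit maps *)

(** If the corner held a 0 while its row and its column both contained a 1, these would lie to its
    left and above it, against [le_filling]. *)
Lemma corner_filling n D f a b : ferrers n D -> le_filling D f -> corner D a b ->
  f a b = (exit n D f (inl a) != inl a) && (exit n D f (inr b) != inr b).
Proof.
move=> FD Lf cD; have /and3P[Dab nDa nDb] := cD.
have [[an bn] down] := (proj1 FD _ _ Dab, proj2 FD).
apply/idP/andP=> [fab|[/(exit_row_fixP _ FD an)Ha /(exit_col_fixP _ FD bn)Hb]].
  split; [apply/(exit_row_fixP _ FD an)|apply/(exit_col_fixP _ FD bn)] => H.
    by have := H _ Dab; rewrite fab.
  by have := H _ Dab; rewrite fab.
apply: contraT => /negP nf; case: Ha => c Dac; apply/negP=> fac.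
case: Hb => r Drb; apply/negP=> frb.
have cb : c < b.
  rewrite ltn_neqAle; apply/andP; split; first by apply/eqP=> e; rewrite -e in nf.
  by rewrite leqNgt; apply: contra nDb => ?; apply: down Dac.
have ra : r < a.
  rewrite ltn_neqAle; apply/andP; split; first by apply/eqP=> e; rewrite -e in nf.
  by rewrite leqNgt; apply: contra nDa => ?; apply: down Drb.
by case: nf; apply: (Lf a b r c).
Qed.

Lemma le_filling_del D f a b : le_filling D f -> le_filling (del D a b) f.
Proof. by move=> Lf r c r' c' /andP[Drc _]; apply: Lf. Qed.

Lemma le_filling_inj n D f g : ferrers n D -> le_filling D f -> le_filling D g ->
  (forall s, is_step n s -> exit n D f s = exit n D g s) ->
  forall r c, D r c -> f r c = g r c.
Proof.
move: D; apply: ferrers_ind => [D D0 _ _ _ r c|D a b FD cD IH Lf Lg E r c Drc].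
  by rewrite D0.
have [/(proj1 FD)[an bn] _ _] := and3P cD.
have fg : f a b = g a b.
  by rewrite (corner_filling FD Lf cD) (corner_filling FD Lg cD) !E.
have [[-> ->] //|ne] := eqVneq (r, c) (a, b).
apply: IH; [exact: le_filling_del|exact: le_filling_del| |by rewrite /del Drc].
move=> s /E; rewrite !(exit_del _ _ FD cD) fg.
by case: ifP => // _ /(can_inj (swapK a b)).
Qed.

(** Deleting the corner only exchanges the consecutive boundary steps [inl a] and [inr b]. If [v]
    holds, exchanging these two values of [q] repairs the order. Otherwise a violation needs [q] to
    send one of the two steps to the other, which must then be the fixed one, against
    injectivity. *)
Lemma reach_del n D a b (q : step -> step) (v := (q (inl a) != inl a) && (q (inr b) != inr b)) :
  ferrers n D -> corner D a b ->
  {in is_step n &, injective q} -> {in is_step n, forall s, reach D s (q s)} ->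
  {in is_step n, forall s, reach (del D a b) s ((if v then swap a b else id) (q s))}.
Proof.
move=> FD cD qI qR; have [Dab nDa nDb] := and3P cD.
have [[an bn] down] := (proj1 FD _ _ Dab, proj2 FD).
case: ifP => [/andP[qa qb] s sn|vF s sn].
  have := qR s sn; rewrite /swap.
  case: eqP => [qs|/eqP nqa].
    case: s sn qs => x /= xn qs; rewrite qs => xa.
      rewrite /del (down a b) //=; apply/eqP=> -[e]; move: qa.
      by rewrite -e qs e eqxx.
    by rewrite leqNgt; apply: contra nDb => ?; apply: down xa.
  case: eqP => [qs|/eqP nqb].
    case: s sn nqa qs => x /= xn _ qs; rewrite qs => xa.
      by rewrite leqNgt; apply: contra nDa => ?; apply: down xa.
    rewrite /del (down a b) //=; apply/eqP=> -[e]; move: qb.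
    by rewrite -e qs e eqxx.
  case: s sn nqa nqb => x /= xn; case: (q _) => y //= nqa nqb Dxy;
    rewrite /del Dxy /=; apply/eqP=> -[e1 e2].
    by rewrite e2 eqxx in nqb.
  by rewrite e1 eqxx in nqa.
have := qR s sn; case E: (q s) => [y|y]; case: s sn E => x /= xn E Dxy //;
  rewrite /del Dxy /=; apply/eqP=> -[e1 e2]; subst x y;
  move: vF; rewrite /v E /= ?andbT => /negbFE/eqP E'.
  by have := qI (inl a) (inr b) an xn; rewrite E E' => /(_ erefl).
by have := qI (inl a) (inr b) xn bn; rewrite E E' => /(_ erefl).
Qed.

(** Without cells, rows go to rows and columns to columns, never to a smaller index; injectivity
    then forces fixed points from the last index downwards. *)
Lemma reach_empty n D (q : step -> step) : (forall r c, D r c = false) ->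
  {in is_step n, forall s, is_step n (q s)} ->
  {in is_step n &, injective q} -> {in is_step n, forall s, reach D s (q s)} ->
  {in is_step n, forall s, q s = s}.
Proof.
move=> D0 qn qI qR.
suff G m s : is_step n s -> n - (match s with inl x | inr x => x end) <= m -> q s = s.
  by move=> s sn; apply: (G n) => //; lia.
elim: m s => [|m IH] s; first by case: s => x /=; lia.
move=> sn lm; have := qR s sn; have := qn s sn.
case E: (q s) => [y|y]; case: s sn lm E => x /= xn lm E yn; rewrite ?D0 //;
  rewrite leq_eqVlt => /orP[/eqP-> //|xy].
  have Ey : q (inl y) = inl y by apply: IH => //=; lia.
  by have := qI (inl x) (inl y) xn yn; rewrite E Ey => /(_ erefl).
have Ey : q (inr y) = inr y by apply: IH => //=; lia.
by have := qI (inr x) (inr y) xn yn; rewrite E Ey => /(_ erefl).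
Qed.

Lemma le_filling_surj n D (q : step -> step) : ferrers n D ->
  {in is_step n, forall s, is_step n (q s)} ->
  {in is_step n &, injective q} -> {in is_step n, forall s, reach D s (q s)} ->
  exists2 f, le_filling D f & {in is_step n, forall s, exit n D f s = q s}.
Proof.
move=> FD; move: D FD q; apply: ferrers_ind => [D D0|D a b FD cD IH] q qn qI qR.
  exists (fun _ _ => false) => [r c|s sn]; first by rewrite D0.
  by rewrite exit_empty // (reach_empty D0 qn).
have [Dab nDa nDb] := and3P cD.
have [[an bn] down] := (proj1 FD _ _ Dab, proj2 FD).
pose v := (q (inl a) != inl a) && (q (inr b) != inr b).
pose h := if v then swap a b else id.
have hK : involutive h by rewrite /h; case: ifP => // _; apply: swapK.
have hn s : is_step n (h s) = is_step n s.
  by rewrite /h; case: ifP => // _; rewrite is_step_swap.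
have [] := IH (fun s => h (q s)).
- by move=> s sn; rewrite hn; apply: qn.
- by move=> s t sn tn /(inv_inj hK); apply: qI.
- exact: (reach_del FD cD qI qR).
move=> f' Lf' Ef'.
pose f r c := if (r, c) == (a, b) then v else f' r c.
have ff' r c : del D a b r c -> f r c = f' r c.
  by rewrite /f => /andP[_ /negPf->].
have fab : f a b = v by rewrite /f eqxx.
have Ef s : is_step n s -> exit n D f s = q s.
  move=> sn; rewrite (exit_del _ _ FD cD) fab -/h (exit_ext _ _ ff').
  by rewrite Ef' // hK.
exists f => // r c r' c' Drc rr cc fr'c frc'.
have Dr'c : D r' c by apply: down Drc => //; apply: ltnW.
have Drc' : D r c' by apply: down Drc => //; apply: ltnW.
have [[er ec]|ne] := eqVneq (r, c) (a, b).
  (* At the corner, the two given 1s make its row and column nonempty, so the exit map fixes neither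
     step and [v] holds. *)
  subst r c; rewrite fab /v -!Ef //.
  apply/andP; split; [apply/(exit_row_fixP _ FD an)|apply/(exit_col_fixP _ FD bn)] => H.
    by have := H _ Drc'; rewrite frc'.
  by have := H _ Dr'c; rewrite fr'c.
(* A cell above or to the left of another cell is not the corner, so it survives the deletion. *)
have dD x y : (x < r) && (y == c) || (x == r) && (y < c) -> D x y -> del D a b x y.
  rewrite /del => xy ->; apply/eqP=> -[ex ey]; subst x y.
  case/orP: xy => /andP[].
    by move=> ar /eqP cb; subst c; case/negP: nDa; apply: down Drc.
  by move=> /eqP ra bc; subst r; case/negP: nDb; apply: down Drc.
rewrite ff' /del ?Drc //; apply: (Lf' r c r' c') => //.
- by rewrite /del Drc.
- by rewrite -ff' // dD // rr eqxx.
- by rewrite -ff' // dD // cc eqxx orbT.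
Qed.

(** * Labels of the boundary steps *)

Definition steps n : seq step := map inl (iota 0 n) ++ map inr (iota 0 n).

Definition row_len n (D : rel nat) r := count (D r) (iota 0 n).

Definition lab n (D : rel nat) (s : step) : nat :=
  match s with
  | inl r => r.+1 + #|[pred c : 'I_n | ~~ D r c]|
  | inr c => n - c + #|[pred r : 'I_n | D r c]|
  end.

Arguments lab : simpl never.

(** Characterises boundary labels by order alone, so that labels read off a permutation can be
    identified with [lab]. *)
Definition labelling n (D : rel nat) (M : step -> nat) :=
  [/\ {in is_step n, forall s, 0 < M s <= 2 * n},
      {in is_step n &, injective M} &
      {in is_step n &, forall s t,
        reach D s t = if s is inl _ then M s <= M t else M t <= M s}].

Lemma mem_steps n s : (s \in steps n) = is_step n s.
Proof.
rewrite mem_cat; case: s => x /=.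
  rewrite mem_map ?mem_iota //=; last by move=> ? ? [].
  by rewrite orbC; case: mapP => // -[].
rewrite [X in _ || X]mem_map ?mem_iota //=; last by move=> ? ? [].
by case: mapP => // -[].
Qed.

Lemma size_steps n : size (steps n) = 2 * n.
Proof. by rewrite size_cat !size_map !size_iota mul2n addnn. Qed.

Lemma uniq_steps n : uniq (steps n).
Proof.
rewrite cat_uniq !map_inj_uniq ?iota_uniq; try by move=> ? ? [].
by rewrite andbT; apply/hasPn => s /mapP[x _ ->]; apply/mapP => -[].
Qed.

Lemma down_count n (u : pred nat) i :
  (forall i, u i -> i < n) -> (forall i j, j <= i -> u i -> u j) ->
  u i = (i < count u (iota 0 n)).
Proof.
elim: n => [|n IH] ub down; first by apply/negP => /ub.
rewrite -[n.+1]addn1 iotaD count_cat /= addn0; case un: (u n) => /=.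
  rewrite (eq_in_count (a2 := predT)); last first.
    by move=> j; rewrite mem_iota => jn; apply: down un; lia.
  rewrite count_predT size_iota addn1 ltnS.
  by apply/idP/idP => [/ub|/down/(_ un)].
rewrite addn0; apply: IH => // j uj; have := ub _ uj.
by rewrite ltnS leq_eqVlt => /orP[/eqP e|//]; rewrite e un in uj.
Qed.

Lemma card_ord_count n (u : pred nat) : #|[pred i : 'I_n | u i]| = count u (iota 0 n).
Proof. by rewrite cardE size_filter -val_enum_ord count_map enumT. Qed.

Lemma row_len_le n D r : row_len n D r <= n.
Proof. by rewrite -[leqRHS](size_iota 0) count_size. Qed.

Lemma row_lenP n D r c : ferrers n D -> D r c = (c < row_len n D r).
Proof.
case=> box down; apply: down_count => [i /box[] //|i j ji]; exact: down.
Qed.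

Lemma col_lenP n D r c : ferrers n D -> D r c = (r < row_len n (tr D) c).
Proof. by move=> FD; apply: (row_lenP c r (ferrers_tr FD)). Qed.

Lemma row_len_anti n D r r' : ferrers n D -> r <= r' -> row_len n D r' <= row_len n D r.
Proof.
move=> FD rr; rewrite leqNgt; apply/negP => lt.
have := row_lenP r (row_len n D r) FD; rewrite ltnn => /negP[].
by apply: (proj2 FD r' (row_len n D r)) => //; rewrite (row_lenP _ _ FD).
Qed.

Lemma lab_row n D r : lab n D (inl r) = r.+1 + (n - row_len n D r).
Proof.
congr (_ + _); rewrite (card_ord_count n (fun c => ~~ D r c)).
by have := count_predC (D r) (iota 0 n); rewrite size_iota /row_len => E;
  rewrite -[X in X - _]E addKn.
Qed.

Lemma lab_col n D c : lab n D (inr c) = n - c + row_len n (tr D) c.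
Proof. by congr (_ + _); apply: card_ord_count. Qed.

Lemma lab_ext n D E s : D =2 E -> lab n D s = lab n E s.
Proof.
by move=> DE; case: s => x /=; congr (_ + _); apply: eq_card => y; rewrite !inE DE.
Qed.

Lemma lab_row_col n D r c : ferrers n D -> r < n -> c < n ->
  if D r c then lab n D (inl r) < lab n D (inr c)
  else lab n D (inr c) < lab n D (inl r).
Proof.
move=> FD rn cn; rewrite lab_row lab_col.
have := row_lenP r c FD; have := col_lenP r c FD.
have := row_len_le n D r; have := row_len_le n (tr D) c.
by case: (D r c); lia.
Qed.

Lemma lab_labelling n D : ferrers n D -> labelling n D (lab n D).
Proof.
move=> FD; have R := row_len_le n; have FT := ferrers_tr FD.
split=> [s|s t|s t].
- case: s => x; rewrite ?lab_row ?lab_col unfold_in /= => xn.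
    by have := R D x; lia.
  by have := R (tr D) x; lia.
- case: s => x; case: t => y; rewrite !unfold_in /= => xn yn E.
  + congr inl; move: E; rewrite !lab_row; have := R D x; have := R D y.
    by case: (leqP x y) => [|/ltnW] xy; have := row_len_anti FD xy; lia.
  + by have := lab_row_col FD xn yn; rewrite E ltnn if_same.
  + by have := lab_row_col FD yn xn; rewrite E ltnn if_same.
  + congr inr; move: E; rewrite !lab_col; have := R (tr D) x; have := R (tr D) y.
    by case: (leqP x y) => [|/ltnW] xy; have := row_len_anti FT xy; lia.
- case: s => x; case: t => y; rewrite !unfold_in /= => xn yn.
  + rewrite !lab_row; have := R D x; have := R D y.
    by case: (leqP x y) => xy; [have := row_len_anti FD xy|have := row_len_anti FD (ltnW xy)]; lia.
  + by have := lab_row_col FD xn yn; case: (D x y); lia.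
  + by have := lab_row_col FD yn xn; case: (D y x); lia.
  + rewrite !lab_col; have := R (tr D) x; have := R (tr D) y.
    by case: (leqP x y) => xy; [have := row_len_anti FT xy|have := row_len_anti FT (ltnW xy)]; lia.
Qed.

Lemma labelling_perm n D M : labelling n D M ->
  perm_eq (map M (steps n)) (iota 1 (2 * n)).
Proof.
case=> Mr MI _; have U : uniq (map M (steps n)).
  by rewrite map_inj_in_uniq ?uniq_steps // => s t; rewrite !mem_steps; apply: MI.
apply: uniq_perm (iota_uniq _ _) _ => //.
apply: (uniq_min_size U _ _).2; last by rewrite size_iota size_map size_steps.
by move=> l /mapP[s]; rewrite mem_steps mem_iota => /Mr ? ->; lia.
Qed.

Lemma labelling_count n D M s : labelling n D M -> is_step n s ->
  M s = count (fun t => M t <= M s) (steps n).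
Proof.
move=> LM sn; have /andP[M0 M2] := let: And3 H _ _ := LM in H s sn.
rewrite -(count_map M (fun l => l <= M s)) (seq.permP (labelling_perm LM)).
have -> : 2 * n = M s + (2 * n - M s) by lia.
rewrite iotaD count_cat (eq_in_count (a2 := predT)); last first.
  by move=> l; rewrite mem_iota /=; lia.
rewrite count_predT size_iota (eq_in_count (a2 := pred0)) ?count_pred0 ?addn0 //.
by move=> l; rewrite mem_iota /=; lia.
Qed.

(** A label is the rank of its step, and the ranks depend only on [reach]. *)
Lemma labelling_uniq n D M M' : labelling n D M -> labelling n D M' ->
  {in is_step n, M =1 M'}.
Proof.
move=> LM LM' s sn; rewrite (labelling_count LM sn) (labelling_count LM' sn).
apply: eq_in_count => t; rewrite mem_steps => tn.
case: LM LM' => _ MI MR [_ MI' MR'].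
have := MR t s tn sn; rewrite (MR' t s tn sn).
case: t tn => // x xn E.
(* For a column, [reach] compares labels the other way round: the strict part follows by negation,
   the equality part by injectivity. *)
rewrite leq_eqVlt [RHS]leq_eqVlt !ltnNge E; congr orb.
by apply/eqP/eqP => [/MI|/MI'] -> //.
Qed.

Definition unlab n (D : rel nat) l : step :=
  nth (inl 0) (steps n) (index l (map (lab n D) (steps n))).

Lemma unlabP n D l : ferrers n D -> 0 < l <= 2 * n ->
  is_step n (unlab n D l) /\ lab n D (unlab n D l) = l.
Proof.
move=> FD l2; have : l \in map (lab n D) (steps n).
  by rewrite (perm_mem (labelling_perm (lab_labelling FD))) mem_iota; lia.
move=> lin; have ix : index l (map (lab n D) (steps n)) < size (steps n).
  by rewrite -(size_map (lab n D)) index_mem.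
split; first by rewrite -mem_steps mem_nth.
by rewrite /unlab -(nth_map _ 0) // nth_index.
Qed.

Lemma labK n D s : ferrers n D -> is_step n s -> unlab n D (lab n D s) = s.
Proof.
move=> FD sn; have [r I _] := lab_labelling FD.
by have [un /I->] := unlabP FD (r s sn).
Qed.

Lemma lab_flip n D s : ferrers n D -> symmetric D -> is_step n s ->
  lab n D (flip s) + lab n D s = 2 * n + 1.
Proof.
move=> FD sD; have RR r : row_len n (tr D) r = row_len n D r.
  by apply: eq_count => c; rewrite /tr sD.
have := row_len_le n D.
by case: s => x /(_ x) Rx /= xn; rewrite lab_row lab_col RR; lia.
Qed.

(** * Symmetric tableaux and symmetric permutations *)

(** The last clause is condition (1): the columns that meet the diagonal are those of the type B
    tableau. *)
Definition symtab n (D f : rel nat) :=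
  [/\ ferrers n D, symmetric D, symmetric f, le_filling D f &
      forall c, D c c -> exists2 r, D r c & f r c].

(* Labels start from 1 and ordinals from 0, as in [is_PhiB].                  *)
Definition papp n (p : 'S_(2 * n)) (l : nat) : nat :=
  oapp (fun i => (p i).+1) 0 (insub l.-1).

Definition realizes n (D f : rel nat) (p : 'S_(2 * n)) : bool :=
  all (fun s => lab n D (exit n D f s) == papp p (lab n D s)) (steps n).

(* Fixed points of the permutation are exits of empty rows or columns, which  *)
(* lie beyond the Durfee square: they are rows exactly when they exceed n.    *)
Definition row_step n (p : 'S_(2 * n)) l :=
  (l < papp p l) || (papp p l == l) && (n < l).

Definition row_labels n (p : 'S_(2 * n)) := filter (row_step p) (iota 1 (2 * n)).

(** Column [c] is labelled by [2 * n + 1] minus the label of row [c], so the inequality says that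
    row [r] precedes column [c] on the boundary. *)
Definition shape_of n (p : 'S_(2 * n)) : rel nat := fun r c =>
  [&& r < n, c < n & nth 0 (row_labels p) r + nth 0 (row_labels p) c <= 2 * n].

Lemma papp_ord n (p : 'S_(2 * n)) (i : 'I_(2 * n)) : papp p i.+1 = (p i).+1.
Proof. by rewrite /papp /= valK. Qed.

Lemma label_ord n l : 0 < l <= 2 * n -> exists i : 'I_(2 * n), l = i.+1.
Proof. by case: l => // l l2; exists (Ordinal (l2 : l < 2 * n)). Qed.

Lemma papp_range n (p : 'S_(2 * n)) l : 0 < l <= 2 * n -> 0 < papp p l <= 2 * n.
Proof. by case/label_ord => i ->; rewrite papp_ord /= ltn_ord. Qed.

Lemma papp_inj n (p : 'S_(2 * n)) :
  {in [pred l | 0 < l <= 2 * n] &, injective (papp p)}.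
Proof.
move=> l l' /label_ord[i ->] /label_ord[j ->]; rewrite !papp_ord => -[/val_inj/perm_inj].
by move->.
Qed.

Lemma is_SPP n (p : 'S_(2 * n)) :
  reflect (forall l, 0 < l <= 2 * n -> papp p (2 * n + 1 - l) = 2 * n + 1 - papp p l)
          (is_SP p).
Proof.
have revE (i : 'I_(2 * n)) : 2 * n + 1 - i.+1 = (rev_ord i).+1.
  by rewrite /=; have := ltn_ord i; lia.
apply: (iffP forallP) => H.
  move=> l /label_ord[i ->]; rewrite revE !papp_ord.
  by have /eqP := H i; lia.
move=> i; have := H i.+1 (ltn_ord i); rewrite revE !papp_ord.
by have := ltn_ord (p i); have := ltn_ord (p (rev_ord i)); lia.
Qed.

Lemma realizesP n D f (p : 'S_(2 * n)) :
  reflect {in is_step n, forall s, lab n D (exit n D f s) = papp p (lab n D s)}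
          (realizes D f p).
Proof.
apply: (iffP allP) => H s; last by rewrite mem_steps => /H->.
by move=> sn; apply/eqP/H; rewrite mem_steps.
Qed.

Lemma exit_flip n D f s : symmetric D -> symmetric f ->
  exit n D f (flip s) = flip (exit n D f s).
Proof.
move=> sD sf; rewrite -exit_tr; case: s => x /=; rewrite (trav_ext (g := tr f)) //;
  by apply: trav_shape_ext => r c; rewrite /tr sD.
Qed.

Lemma symtab_perm n D f : symtab n D f ->
  exists2 p : 'S_(2 * n), is_SP p & realizes D f p.
Proof.
case=> FD sD sf _ _; have [Lr LI _] := lab_labelling FD.
have /fin_all_exists[g gE] (i : 'I_(2 * n)) :
    exists j : 'I_(2 * n), lab n D (exit n D f (unlab n D i.+1)) = j.+1.
  have [un _] := unlabP FD (ltn_ord i : 0 < i.+1 <= 2 * n).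
  by apply: label_ord; apply: Lr; rewrite -[_ \in _]/(is_step n _) exit_step.
have gI : injective g.
  move=> i j gij; have := gE i; rewrite gij -gE.
  have [ui Ei] := unlabP FD (ltn_ord i : 0 < i.+1 <= 2 * n).
  have [uj Ej] := unlabP FD (ltn_ord j : 0 < j.+1 <= 2 * n).
  move/LI; rewrite -![_ \in _]/(is_step n _) !exit_step // => /(_ ui uj)/(exit_inj FD) E.
  by apply/val_inj/succn_inj; rewrite -Ei E Ej.
have R : realizes D f (perm gI).
  apply/realizesP => s sn; have [i Ei] := label_ord (Lr s sn).
  by rewrite Ei papp_ord permE -gE -Ei labK.
exists (perm gI) => //; apply/is_SPP => l l2.
have [sn sE] := unlabP FD l2; rewrite -sE; set s := unlab n D l in sn *.
have sfn : is_step n (flip s) by rewrite is_step_flip.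
have -> : 2 * n + 1 - lab n D s = lab n D (flip s) by have := lab_flip FD sD sn; lia.
have /realizesP H := R; rewrite -!H // exit_flip //.
by have := lab_flip FD sD (_ : is_step n (exit n D f s)); rewrite exit_step // => /(_ sn); lia.
Qed.

Lemma row_stepP n D f (p : 'S_(2 * n)) s : symtab n D f -> realizes D f p ->
  is_step n s -> row_step p (lab n D s) = if s is inl _ then true else false.
Proof.
move=> [FD sD sf Lf cov] /realizesP R sn; rewrite /row_step -R //.
have [Lr LI LR] := lab_labelling FD.
have en : is_step n (exit n D f s) by rewrite exit_step.
have := exit_reach f s FD; rewrite LR //.
have Efix : (lab n D (exit n D f s) == lab n D s) = (exit n D f s == s).
  by apply/eqP/eqP => [/LI->|->].
rewrite Efix.
(* A column without 1s misses the diagonal, so step [inr x] precedes [inl x]; as their labels add up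
   to [2 * n + 1], they lie on either side of the middle. *)
have diag x : x < n -> (forall r, D r x -> ~~ f r x) -> lab n D (inr x) <= n < lab n D (inl x).
  move=> xn H; have := lab_row_col FD xn xn; have := lab_flip (s := inl x) FD sD xn.
  case Dxx: (D x x); first by case: (cov x Dxx) => r /H /negPf->.
  by rewrite /=; lia.
case: s sn en Efix => x xn en Efix le.
  have [/eqP/(exit_row_fixP f FD xn) H|ne] := eqVneq (exit n D f (inl x)) (inl x).
    have /(diag x xn)/andP[_ ->] : forall r, D r x -> ~~ f r x.
      by move=> r; rewrite sD sf; apply: H.
    by rewrite orbT.
  by rewrite orbF ltn_neqAle le eq_sym Efix ne.
rewrite ltnNge le /=; case: eqP => // /eqP/(exit_col_fixP f FD xn) H.
by have /andP[] := diag x xn H; lia.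
Qed.

Lemma row_labels_nth n D f (p : 'S_(2 * n)) r : symtab n D f -> realizes D f p ->
  r < n -> nth 0 (row_labels p) r = lab n D (inl r).
Proof.
move=> S R rn; have [FD _ _ _ _] := S; have [Lr _ LR] := lab_labelling FD.
suff -> : row_labels p = map (fun r => lab n D (inl r)) (iota 0 n).
  by rewrite (nth_map 0) ?size_iota // nth_iota.
apply: (irr_sorted_eq ltn_trans ltnn).
- by apply: sorted_filter; [exact: ltn_trans|exact: iota_ltn_sorted].
- rewrite sorted_map; apply: (sub_in_sorted (P := [pred r | r < n])) (iota_ltn_sorted 0 n).
    move=> x y xn yn /= xy; rewrite ltnNge; apply/negP => yx.
    by have := LR (inl y) (inl x) yn xn; rewrite yx /= leqNgt xy.
  by apply/allP => x; rewrite mem_iota.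
move=> l; rewrite mem_filter mem_iota; apply/andP/mapP => [[rl lr]|[x]].
  have [sn sE] : is_step n (unlab n D l) /\ lab n D (unlab n D l) = l.
    by apply: unlabP FD _; lia.
  move: rl; rewrite -sE (row_stepP S R sn).
  by case: (unlab n D l) sn => // x xn _; exists x; rewrite ?mem_iota.
rewrite mem_iota => xn ->; rewrite (row_stepP S R) //.
by split=> //; rewrite add1n ltnS; apply: Lr.
Qed.

Lemma symtab_shape n D f (p : 'S_(2 * n)) : symtab n D f -> realizes D f p ->
  D =2 shape_of p.
Proof.
move=> S R r c; have [FD sD _ _ _] := S; rewrite /shape_of.
apply/idP/and3P => [Drc|[rn cn]].
  have [rn cn] := proj1 FD _ _ Drc; split=> //; rewrite !(row_labels_nth S R) //.
  have := lab_row_col FD rn cn; rewrite Drc.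
  by have := lab_flip (s := inl c) FD sD cn; rewrite /=; lia.
rewrite !(row_labels_nth S R) //; have := lab_row_col FD rn cn.
by case: (D r c) => //; have := lab_flip (s := inl c) FD sD cn; rewrite /=; lia.
Qed.

Lemma symtab_inj n D f E g (p : 'S_(2 * n)) :
  symtab n D f -> realizes D f p -> symtab n E g -> realizes E g p ->
  D =2 E /\ forall r c, D r c -> f r c = g r c.
Proof.
move=> SD RD SE RE.
have DE : D =2 E by move=> r c; rewrite (symtab_shape SD RD) (symtab_shape SE RE).
split=> //; have [[FD _ _ Lf _] [FE _ _ Lg _]] := (SD, SE).
apply: (le_filling_inj FD Lf) => [r c r' c'|s sn]; first by rewrite DE; apply: Lg.
have -> : exit n D g s = exit n E g s by case: (s) => x; apply: trav_shape_ext.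
have [_ I _] := lab_labelling FE; apply: I; rewrite -?[_ \in _]/(is_step n _) ?exit_step //.
by rewrite (realizesP _ _ _ RE) // -!(lab_ext _ _ DE) (realizesP _ _ _ RD).
Qed.

(** * The symmetric tableau of a symmetric permutation *)

Section Surjectivity.

Variables (n : nat) (p : 'S_(2 * n)).
Hypothesis SPp : is_SP p.

Let flipl l := 2 * n + 1 - l.

(** Reversal exchanges [l < papp p l] with the opposite inequality, and fixed points above [n] with
    those up to [n]. *)
Lemma row_step_rev l : 0 < l <= 2 * n -> row_step p (2 * n + 1 - l) = ~~ row_step p l.
Proof.
move=> l2; rewrite /row_step (is_SPP _ SPp) //.
have := papp_range p l2; move: (papp p l) => m m2.
by apply/idP/idP; lia.
Qed.

Lemma size_row_labels : size (row_labels p) = n.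
Proof.
have C : count (row_step p) (iota 1 (2 * n)) = count (predC (row_step p)) (iota 1 (2 * n)).
  have P : perm_eq (map flipl (iota 1 (2 * n))) (iota 1 (2 * n)).
    apply: uniq_perm (iota_uniq _ _) _; rewrite ?map_inj_in_uniq ?iota_uniq //.
      by move=> x y; rewrite !mem_iota /flipl; lia.
    move=> l; apply/mapP/idP => [[x]|]; rewrite !mem_iota => xl.
      by move=> ->; rewrite /flipl; lia.
    by exists (flipl l); rewrite ?mem_iota /flipl; lia.
  rewrite -(seq.permP P) count_map; apply: eq_in_count => l; rewrite mem_iota => l2 /=.
  by rewrite /flipl row_step_rev //; lia.
by rewrite size_filter; have := count_predC (row_step p) (iota 1 (2 * n)); rewrite -C size_iota; lia.
Qed.

Let ls := row_labels p.

(** Candidate labels for [shape_of p]; they equal [lab] once shown to form a labelling. *)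
Definition label_of (s : step) : nat :=
  match s with inl r => nth 0 (row_labels p) r
             | inr c => 2 * n + 1 - nth 0 (row_labels p) c end.

Lemma row_labelsP r : r < n -> 0 < nth 0 ls r <= 2 * n /\ row_step p (nth 0 ls r).
Proof.
move=> rn; have : nth 0 ls r \in ls by rewrite mem_nth // size_row_labels.
by rewrite mem_filter mem_iota => /andP[-> ?]; split=> //; lia.
Qed.

Lemma row_labels_le r r' : r < n -> r' < n -> (nth 0 ls r <= nth 0 ls r') = (r <= r').
Proof.
have mono x y : x < y -> y < n -> nth 0 ls x < nth 0 ls y.
  move=> xy yn; apply: (sorted_ltn_nth ltn_trans) => //; rewrite ?inE ?size_row_labels //.
    by apply: sorted_filter; [exact: ltn_trans|exact: iota_ltn_sorted].
  exact: ltn_trans yn.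
by move=> rn rn'; case: (ltngtP r r') => [/mono|/mono|->]; lia.
Qed.

(** The mirror image of a row label is never a row label. This separates the candidate labels of
    rows from those of columns. *)
Lemma row_labels_sum r c : r < n -> c < n -> nth 0 ls r + nth 0 ls c != 2 * n + 1.
Proof.
move=> rn cn; have [[rr wr] [rc wc]] := (row_labelsP rn, row_labelsP cn).
apply/eqP => E; have := row_step_rev rc; rewrite wc.
have -> : 2 * n + 1 - nth 0 ls c = nth 0 ls r by lia.
by rewrite wr.
Qed.

Lemma ferrers_shape_of : ferrers n (shape_of p).
Proof.
split=> [r c /and3P[] //|r c r' c' rr cc /and3P[rn cn le]].
apply/and3P; split; [lia|lia|].
have : nth 0 ls r' <= nth 0 ls r by rewrite row_labels_le //; lia.
have : nth 0 ls c' <= nth 0 ls c by rewrite row_labels_le //; lia.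
by rewrite -/ls in le *; lia.
Qed.

Lemma shape_of_sym : symmetric (shape_of p).
Proof. by move=> r c; rewrite /shape_of andbCA addnC. Qed.

Lemma label_of_labelling : labelling n (shape_of p) label_of.
Proof.
split=> [s|s t|s t].
- case: s => x xn; have [? _] := row_labelsP xn; rewrite /= -/ls; lia.
- case: s => x; case: t => y; rewrite !unfold_in /= -/ls => xn yn;
    have [xl _] := row_labelsP xn; have [yl _] := row_labelsP yn;
    have := row_labels_sum xn yn; have := row_labels_le xn yn;
    have := row_labels_le yn xn => A B C E.
  + by congr inl; lia.
  + by lia.
  + by lia.
  + by congr inr; lia.
- case: s => x; case: t => y; rewrite !unfold_in /= /shape_of -/ls => xn yn;
    have [xl _] := row_labelsP xn; have [yl _] := row_labelsP yn;
    have := row_labels_sum xn yn; have := row_labels_le xn yn;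
    have := row_labels_le yn xn; rewrite ?xn ?yn /=; lia.
Qed.

Lemma symtab_exists : exists D f, symtab n D f /\ realizes D f p.
Proof.
set D := shape_of p; have FD : ferrers n D := ferrers_shape_of.
have sD : symmetric D := shape_of_sym.
have [Lr LI LR] := lab_labelling FD.
have labE : {in is_step n, lab n D =1 label_of}.
  exact: labelling_uniq (lab_labelling FD) label_of_labelling.
pose q s := unlab n D (papp p (lab n D s)).
have qP s : is_step n s -> is_step n (q s) /\ lab n D (q s) = papp p (lab n D s).
  by move=> sn; apply: unlabP => //; apply/papp_range/Lr.
have rowE s : is_step n s -> row_step p (lab n D s) = if s is inl _ then true else false.
  move=> sn; rewrite labE //; case: s sn => x xn; have [xl wx] := row_labelsP xn => //.
  by rewrite /= row_step_rev // wx.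
have [|||f Lf fE] := @le_filling_surj n D q FD.
- by move=> s /qP[].
- move=> s t sn tn E; apply: LI => //; apply: (@papp_inj _ p); [exact: Lr|exact: Lr|].
  by rewrite -(qP s sn).2 -(qP t tn).2 E.
(* By [row_step], [p] does not decrease a row label and does not increase a column label. *)
- move=> s sn; have [qn qE] := qP s sn; rewrite LR // qE; have := rowE s sn.
  by rewrite /row_step; case: s sn {qn qE} => x xn; case: ltngtP.
have R : realizes D f p by apply/realizesP => s sn; rewrite fE // (qP s sn).2.
have fs r c : D r c -> f r c = f c r.
  (* The transposed filling has the same exit map, because [p] commutes with reversal of labels. *)
  move=> Drc; apply: (le_filling_inj (g := tr f) FD Lf) Drc => [|s sn].
    move=> {}r {}c r' c' Drc rr cc; rewrite /tr => f1 f2.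
    by apply: (Lf c r c' r') => //; rewrite sD.
  have ->: exit n D (tr f) s = exit n (tr D) (tr f) s.
    by case: (s) => x; apply: trav_shape_ext => r' c'; rewrite /tr sD.
  have flipn u : is_step n u -> is_step n (flip u) by rewrite is_step_flip.
  rewrite -[s in RHS]flipK exit_tr !fE //; last exact: flipn.
  have [[qn qE] [qfn qfE]] := (qP _ sn, qP _ (flipn _ sn)).
  apply: (inv_inj flipK); rewrite flipK; apply: LI; [exact: flipn|exact: qfn|].
  rewrite qfE; have := lab_flip FD sD sn; have := lab_flip FD sD qn; rewrite qE => A B.
  have -> : lab n D (flip s) = 2 * n + 1 - lab n D s by lia.
  by rewrite (is_SPP _ SPp) ?Lr //; lia.
(* [f] is arbitrary outside [D]; clearing it there makes it symmetric everywhere. *)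
exists D, (fun r c => f r c && D r c); split; last first.
  apply/realizesP => s sn; rewrite -(realizesP _ _ _ R) //; congr lab.
  by apply: exit_ext => r c ->; rewrite andbT.
split=> //.
- by move=> r c; case Drc: (D r c); rewrite [D c r]sD Drc ?andbF // fs.
- move=> r c r' c' Drc rr cc /andP[f1 _] /andP[f2 _]; rewrite Drc andbT.
  exact: Lf Drc rr cc f1 f2.
move=> c Dcc; have [cn _] := proj1 FD _ _ Dcc.
(* A fixed row label exceeds [n], whereas a row that meets the diagonal has label at most [n]. *)
have : exit n D f (inl c) != inl c.
  apply/eqP => E; have := rowE (inl c) cn; rewrite /row_step -(realizesP _ _ _ R) // E.
  rewrite eqxx ltnn /=; have := lab_row_col FD cn cn; rewrite Dcc.
  by have := lab_flip (s := inl c) FD sD cn; rewrite /=; lia.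
rewrite exit_row_fix // negbK => /hasP[r _ /andP[Dcr fcr]].
by exists r; rewrite sD ?Dcr ?andbT // -fs.
Qed.

End Surjectivity.

(** * Type B permutation tableaux *)

(** The encoding makes [PTB n] a choice type, so that [xchoose] can pick preimages. *)
Definition tableau_code (T : tableau) := (ncols T, frows T, filling T).
Definition tableau_decode (x : nat * seq nat * seq bitseq) :=
  Tableau x.1.1 x.1.2 x.2.

Lemma tableau_codeK : cancel tableau_code tableau_decode.
Proof. by case. Qed.

HB.instance Definition _ := Countable.copy tableau (can_type tableau_codeK).

Lemma in_shiftedE T r c : in_shifted T r c =
  if r < ncols T then c <= r else c < nth 0 (frows T) (r - ncols T).
Proof.
rewrite /in_shifted nth_cat size_iota; case: ifP => // rk.
by rewrite nth_iota // add1n ltnS.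
Qed.

Lemma in_sym_sym T : symmetric (in_sym T).
Proof. by move=> r c; rewrite /in_sym orbC. Qed.

Lemma sym_one_sym T : symmetric (sym_one T).
Proof. by move=> r c; rewrite /sym_one orbC. Qed.

(** * From type B tableaux to symmetric tableaux *)

Section Translation.

Variables (n : nat) (T : tableau).
Hypothesis PT : is_PTB n T.

Local Notation k := (ncols T).
Local Notation len r := (nth 0 (frows T) (r - k)).

Lemma PTB_length : tlength T = n.
Proof. by case/and5P: PT => _ /eqP. Qed.

Lemma frows_le r : len r <= k.
Proof.
have /andP[/andP[_ /allP H] _] := PT.
case: (ltnP (r - k) (size (frows T))) => rs; last by rewrite nth_default.
exact/H/mem_nth.
Qed.

Lemma frows_anti r r' : r <= r' -> len r' <= len r.
Proof.
have /andP[/andP[s _] _] := PT => rr.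
case: (ltnP (r' - k) (size (frows T))) => rs; last by rewrite nth_default.
have geq_trans : transitive geq by move=> x y z; rewrite /=; lia.
by apply: (sorted_leq_nth geq_trans leqnn 0 s); rewrite ?inE; lia.
Qed.

Lemma frows_out r : n <= r -> len r = 0.
Proof. by move=> nr; have := PTB_length; rewrite /tlength => E; rewrite nth_default //; lia. Qed.

Lemma in_symE r c :
  in_sym T r c = if r < k then (c < k) || (r < len c) else c < len r.
Proof.
rewrite /in_sym !in_shiftedE; have := frows_le r; have := frows_le c.
by case: ifP => ?; case: ifP => ?; lia.
Qed.

Lemma ferrers_in_sym : ferrers n (in_sym T).
Proof.
have := PTB_length; rewrite /tlength => E.
split=> [r c|r c r' c' rr cc].
  rewrite in_symE; have := @frows_out r; have := @frows_out c.
  have := frows_le r; have := frows_le c.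
  by case: (leqP n r); case: (leqP n c); case: ifP; lia.
rewrite !in_symE; have := frows_le r; have := frows_le c.
have := frows_le r'; have := frows_le c'; have := frows_anti rr; have := frows_anti cc.
by case: ifP; case: ifP; lia.
Qed.

(** The number of columns is thus the side of the Durfee square of the symmetric diagram, and can be
    read off it. *)
Lemma in_sym_diag r : in_sym T r r = (r < k).
Proof. by rewrite in_symE; have := frows_le r; case: ifP; lia. Qed.

Lemma size_row r : size (nth [::] (filling T) r) = nth 0 (shifted_shape T) r.
Proof.
have /and5P[_ _ /eqP <- _ _] := PT.
case: (ltnP r (size (filling T))) => rs; first by rewrite (nth_map [::]).
by rewrite !nth_default ?size_map.
Qed.

Lemma one_shifted r c : one T r c -> in_shifted T r c.
Proof.
rewrite /one /in_shifted -size_row; case: ltnP => // H; by rewrite nth_default.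
Qed.

Lemma in_shifted_le r c : in_shifted T r c -> c <= r.
Proof. by rewrite in_shiftedE; have := frows_le r; case: ifP; lia. Qed.

Lemma sym_one_low r c : c <= r -> sym_one T r c = one T r c.
Proof.
rewrite /sym_one leq_eqVlt => /orP[/eqP->|cr]; first by rewrite orbb.
by rewrite [one T c r]negbTE ?orbF //; apply/negP => /one_shifted/in_shifted_le; lia.
Qed.

Lemma one_diag c r : c < k -> r < c -> one T c r -> one T c c.
Proof.
move=> ck rc cr; have /and5P[_ _ _ _ /andP[_ /forallP H]] := PT.
move: (H (Ordinal ck)); rewrite /= /zero in_shiftedE ck leqnn /=.
case: (one T c c) => //= /existsP[]; by exists (Ordinal rc).
Qed.

Lemma one_fill r c r' c' : in_shifted T r c -> r' < r -> c' < c ->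
  one T r' c -> one T r c' -> one T r c.
Proof.
move=> Drc rr cc f1 f2; have /and5P[_ _ _ _ /andP[/forallP H _]] := PT.
have [rn _] := proj1 ferrers_in_sym r c (introT orP (or_introl Drc)).
have ck : c < k by move: Drc; rewrite in_shiftedE; have := frows_le r; case: ifP; lia.
have /forallP/(_ (Ordinal ck)) := H (Ordinal rn); rewrite /= /zero Drc /=.
case: (one T r c) => //= /negP[]; apply/andP.
by split; apply/existsP; [exists (Ordinal rr)|exists (Ordinal cc)].
Qed.

Lemma le_filling_sym_one : le_filling (in_sym T) (sym_one T).
Proof.
suff low r c r' c' : in_shifted T r c -> r' < r -> c' < c ->
    sym_one T r' c -> sym_one T r c' -> sym_one T r c.
  move=> r c r' c' /orP[Drc|Dcr] rr cc f1 f2; first exact: low Drc rr cc f1 f2.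
  by rewrite sym_one_sym; apply: low Dcr cc rr _ _; rewrite sym_one_sym.
move=> Drc rr cc; have cr := in_shifted_le Drc.
have ck : c < k by move: Drc; rewrite in_shiftedE; have := frows_le r; case: ifP; lia.
rewrite !(sym_one_low cr) (@sym_one_low r c'); last by lia.
(* If [c <= r'], all cells lie in the original tableau. Otherwise the 1 at [(r', c)] mirrors a 1 in
   the added row [c], condition (3) gives a 1 at [(c, c)], and this serves as the 1 above
   [(r, c)]. *)
case: (leqP c r') => r'c f1 f2.
  by rewrite sym_one_low // in f1; apply: one_fill Drc rr cc f1 f2.
rewrite sym_one_sym sym_one_low ?(ltnW r'c) // in f1.
have fcc := one_diag ck r'c f1.
have [<-|ne] := eqVneq c r; first by [].
by apply: one_fill Drc _ cc fcc f2; lia.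
Qed.

Lemma symtab_PTB : symtab n (in_sym T) (sym_one T).
Proof.
split; [exact: ferrers_in_sym|exact: in_sym_sym|exact: sym_one_sym|exact: le_filling_sym_one|].
move=> c; rewrite in_sym_diag => ck.
have /and5P[_ _ _ /forallP/(_ (Ordinal ck))/existsP[r /= f1] _] := PT.
by exists r; rewrite /in_sym /sym_one ?f1 // one_shifted.
Qed.

End Translation.

Lemma PTB_inj n T T' : is_PTB n T -> is_PTB n T' -> in_sym T =2 in_sym T' ->
  (forall r c, in_sym T r c -> sym_one T r c = sym_one T' r c) -> T = T'.
Proof.
move=> PT PT' DD ff.
have kk : ncols T = ncols T'.
  have := in_sym_diag PT' (ncols T); have := in_sym_diag PT (ncols T').
  have := in_sym_diag PT (ncols T); have := in_sym_diag PT' (ncols T').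
  by rewrite !DD; do 2 case: (in_sym T' _ _); lia.
have [l1 l2] := (PTB_length PT, PTB_length PT'); rewrite /tlength in l1 l2.
have FF : frows T = frows T'.
  apply: (@eq_from_nth _ 0) => [|i _]; first by lia.
  have H c : (c < nth 0 (frows T) i) = (c < nth 0 (frows T') i).
    have := DD (ncols T + i) c; rewrite (in_symE PT) (in_symE PT') kk.
    by rewrite ltnNge leq_addr /= addKn.
  have := H (nth 0 (frows T) i); have := H (nth 0 (frows T') i).
  by rewrite !ltnn; lia.
have SS : shifted_shape T = shifted_shape T' by rewrite /shifted_shape kk FF.
have [s1 s2] : shape (filling T) = shifted_shape T /\ shape (filling T') = shifted_shape T'.
  by have [/and5P[_ _ /eqP ? _ _] /and5P[_ _ /eqP ? _ _]] := (PT, PT').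
have fill : filling T = filling T'.
  apply: (@eq_from_nth _ [::]) => [|r _].
    by rewrite -[LHS](size_map size) -[RHS](size_map size) -!/(shape _) s1 s2 SS.
  apply: (@eq_from_nth _ false) => [|c]; first by rewrite (size_row PT) (size_row PT') SS.
  rewrite (size_row PT) => rc; have cr := in_shifted_le PT rc.
  have := ff r c; rewrite (sym_one_low PT cr) (sym_one_low PT' cr); apply.
  by rewrite /in_sym [in_shifted T r c]rc.
by rewrite -[T]tableau_codeK -[T']tableau_codeK /tableau_code kk FF fill.
Qed.

(** * From symmetric tableaux to type B tableaux *)

Section TableauOf.

Variables (n : nat) (D f : rel nat).
Hypothesis symD : symtab n D f.

(** The side of the Durfee square: rows above this index are cut at the diagonal, the others are
    kept whole. *)
Let k := count (fun r => D r r) (iota 0 n).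
Let len r := if r < k then r.+1 else row_len n D r.

Definition tableau_of :=
  Tableau k (map (row_len n D) (iota k (n - k))) (mkseq (fun r => mkseq (f r) (len r)) n).

Let FD : ferrers n D. Proof. by case: symD. Qed.

Lemma diag_lt r : D r r = (r < k).
Proof.
by apply: (down_count (u := fun r => D r r)) => [i /(proj1 FD)[]//|i j ji]; apply: (proj2 FD).
Qed.

Lemma k_le : k <= n.
Proof. by rewrite -[leqRHS](size_iota 0) count_size. Qed.

Lemma in_shifted_of r c : in_shifted tableau_of r c = (c < len r).
Proof.
rewrite in_shiftedE /= /len; case: ltnP => // kr.
case: (ltnP r n) => rn; first by rewrite (nth_map 0) ?size_iota ?nth_iota ?subnKC //; lia.
rewrite nth_default ?size_map ?size_iota; last by lia.
rewrite -(row_lenP _ _ FD) ltn0; symmetry; apply/negP => /(proj1 FD); lia.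
Qed.

Lemma in_sym_of : in_sym tableau_of =2 D.
Proof.
have [_ sD _ _ _] := symD => r c.
have low x y : x < k -> y < k -> D x y.
  by rewrite -!diag_lt => ? ?; case: (leqP x y) => xy; [apply: (proj2 FD y y)|apply: (proj2 FD x x)] => //; apply: ltnW.
rewrite /in_sym !in_shifted_of /len.
case: (ltnP r k) => rk; case: (ltnP c k) => ck; rewrite -?(row_lenP _ _ FD).
- by rewrite low //; lia.
- rewrite [D c r]sD; case Drc: (D r c); rewrite ?orbT ?orbF //.
  by apply/negbTE; lia.
- case Drc: (D r c) => //=; lia.
- by rewrite [D c r]sD orbb.
Qed.

Lemma one_of r c : one tableau_of r c = in_shifted tableau_of r c && f r c.
Proof.
rewrite in_shifted_of /one /=; case: (ltnP r n) => rn.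
  rewrite nth_mkseq //; case: ltnP => cl; first by rewrite nth_mkseq.
  by rewrite nth_default ?size_mkseq.
rewrite (nth_default [::]) ?size_mkseq // nth_nil; symmetry; apply/negP => /andP[].
rewrite /len [r < k]ltnNge (leq_trans k_le rn) /= -(row_lenP _ _ FD) => /(proj1 FD); lia.
Qed.

Lemma sym_one_of r c : sym_one tableau_of r c = D r c && f r c.
Proof.
have [_ _ sf _ _] := symD.
by rewrite /sym_one !one_of [f c r]sf -andb_orl -in_sym_of.
Qed.

Lemma is_PTB_of : is_PTB n tableau_of.
Proof.
have [_ sD sf Lf cov] := symD; have kn := k_le.
have shD r c : in_shifted tableau_of r c -> D r c by rewrite -in_sym_of /in_sym => ->.
(* A 1 and its mirror image are the witnesses for [le_filling] at the diagonal cell, which yields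
   condition (3). *)
have one_diag_of r c : D c c -> f c r -> r < c -> f c c.
  by move=> Dcc fcr rc; apply: (Lf c c r r); rewrite // sf.
apply/and5P; split.
- apply/andP; split.
    apply/(sortedP 0) => i; rewrite size_map size_iota => ik.
    rewrite !(nth_map 0) ?size_iota ?nth_iota //=; try lia.
    by apply: row_len_anti FD _; lia.
  apply/allP => l /mapP[r]; rewrite mem_iota => /andP[kr _] ->.
  (* A longer row would have a cell in column [k], and then [(k, k)] would belong to the diagram. *)
  rewrite leqNgt -(row_lenP _ _ FD); apply/negP => Drk.
  by have := diag_lt k; rewrite ltnn (proj2 FD r k).
- by rewrite /tlength /= size_map size_iota subnK.
- apply/eqP/(@eq_from_nth _ 0) => [|r].
    by rewrite size_map size_mkseq size_cat size_map !size_iota subnKC.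
  rewrite size_map size_mkseq => rn; rewrite (nth_map [::]) ?size_mkseq //.
  rewrite nth_mkseq // size_mkseq.
  have H c : (c < len r) = (c < nth 0 (shifted_shape tableau_of) r) by rewrite -in_shifted_of.
  by have := H (len r); have := H (nth 0 (shifted_shape tableau_of) r); rewrite !ltnn; lia.
- apply/forallP => -[c /= ck]; apply/existsP.
  have Dcc : D c c by rewrite diag_lt.
  have [r Drc frc] := cov c Dcc.
  case: (leqP c r) => cr.
    have [rn _] := proj1 FD _ _ Drc; exists (Ordinal rn); rewrite one_of frc andbT in_shifted_of /len /=.
    by case: ifP => // _; rewrite -(row_lenP _ _ FD) Drc.
  (* The 1 found lies above the diagonal, outside the shifted diagram; the diagonal cell of the
     column replaces it. *)
  have [cn _] := proj1 FD _ _ Dcc; exists (Ordinal cn); rewrite one_of in_shifted_of /len /= ck.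
  by rewrite ltnSn /= (one_diag_of r) // sf.
apply/andP; split.
  apply/forallP => r; apply/forallP => c; apply/implyP; rewrite /zero one_of.
  case/andP=> sh; rewrite sh /= => nf; apply/negP => /andP[].
  case/existsP=> r'; rewrite one_of => /andP[_ f1]; case/existsP => c'.
  rewrite one_of => /andP[_ f2]; case/negP: nf.
  exact: Lf (shD _ _ sh) (ltn_ord r') (ltn_ord c') f1 f2.
apply/forallP => r; apply/implyP; rewrite /zero one_of.
case/andP=> sh; rewrite sh /= => nf; apply/negP => /existsP[c].
rewrite one_of => /andP[_ f1]; case/negP: nf.
exact: one_diag_of (shD _ _ sh) f1 (ltn_ord c).
Qed.

End TableauOf.

(* Zigzag paths computed by [trav] *)
Scheme travel_east_mut := Minimality for travel_east Sort Prop
  with travel_south_mut := Minimality for travel_south Sort Prop.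
Combined Scheme travel_mut from travel_east_mut, travel_south_mut.

Section Zigzag.

Variable T : tableau.
Local Notation n := (tlength T).
Local Notation D := (in_sym T).
Local Notation f := (sym_one T).
Hypothesis FD : ferrers n D.

(** When the fuel runs out, [r + c] is at least [n + n], so the position is outside the diagram and
    the default answer of [trav] is the true exit. *)
Lemma travel_trav m r c : n + n <= m + r + c ->
  travel_east T r c (lab n D (trav D f m true r c)) /\
  travel_south T r c (lab n D (trav D f m false r c)).
Proof.
elim: m r c => [|m IH] r c mrc /=.
  have nD : ~~ D r c by apply/negP => /(proj1 FD); lia.
  by split; [apply: east_exit|apply: south_exit].
case: ifP => [Drc|/negbT nD]; last by split; [apply: east_exit|apply: south_exit].
have [e1 s1] := IH r c.+1 (ltac:(lia)).
have [e2 s2] := IH r.+1 c (ltac:(lia)).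
case frc: (f r c) => /=; split.
- exact: east_turn.
- exact: south_turn.
- by apply: east_straight; rewrite ?frc.
- by apply: south_straight; rewrite ?frc.
Qed.

Lemma trav_travel :
  (forall r c j, travel_east T r c j ->
     forall m, n + n <= m + r + c -> j = lab n D (trav D f m true r c)) /\
  (forall r c j, travel_south T r c j ->
     forall m, n + n <= m + r + c -> j = lab n D (trav D f m false r c)).
Proof.
apply: (travel_mut (T := T)
  (P := fun r c j => forall m, n + n <= m + r + c -> j = lab n D (trav D f m true r c))
  (P0 := fun r c j => forall m, n + n <= m + r + c -> j = lab n D (trav D f m false r c))).
- by move=> r c nD [|m] _ //=; rewrite (negPf nD).
- move=> r c j Drc nf _ IH [|m] mrc; first by have := proj1 FD _ _ Drc; lia.
  by rewrite /= Drc (negPf nf) /=; apply: IH; lia.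
- move=> r c j Drc nf _ IH [|m] mrc; first by have := proj1 FD _ _ Drc; lia.
  by rewrite /= Drc nf /=; apply: IH; lia.
- by move=> r c nD [|m] _ //=; rewrite (negPf nD).
- move=> r c j Drc nf _ IH [|m] mrc; first by have := proj1 FD _ _ Drc; lia.
  by rewrite /= Drc (negPf nf) /=; apply: IH; lia.
- move=> r c j Drc nf _ IH [|m] mrc; first by have := proj1 FD _ _ Drc; lia.
  by rewrite /= Drc nf /=; apply: IH; lia.
Qed.

Lemma zigzagP i j :
  zigzag T i j <-> exists s, [/\ is_step n s, lab n D s = i & lab n D (exit n D f s) = j].
Proof.
split=> [[r rn <-|c cn <-]|[[r|c] [sn <- <-]]].
- by move=> /(proj1 trav_travel)/(_ (n + n)) ->; [exists (inl r)|lia].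
- by move=> /(proj2 trav_travel)/(_ (n + n)) ->; [exists (inr c)|lia].
- by apply: (zigzag_row (r := r)) => //; apply: (proj1 (travel_trav _)); lia.
- by apply: (zigzag_col (c := c)) => //; apply: (proj2 (travel_trav _)); lia.
Qed.

End Zigzag.

(** * The bijection between tableaux and permutations *)

Definition tab_realizes n (T : tableau) (p : 'S_(2 * n)) : bool :=
  realizes (in_sym T) (sym_one T) p.

Lemma realizes_zigzag n T (p : 'S_(2 * n)) (i : 'I_(2 * n)) j :
  is_PTB n T -> tab_realizes T p -> zigzag T i.+1 j <-> j = (p i).+1.
Proof.
move=> PT /realizesP R; have FD := ferrers_in_sym PT; have E := PTB_length PT.
rewrite -E in FD; rewrite (zigzagP FD); rewrite E in FD *.
split=> [[s [sn si <-]]|->]; first by rewrite R // si papp_ord.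
have [sn sE] := unlabP FD (ltn_ord i : 0 < i.+1 <= 2 * n).
by exists (unlab n (in_sym T) i.+1); rewrite R // sE papp_ord.
Qed.

Lemma PTB_realized n (T : PTB n) : exists p : SP n, tab_realizes (sval T) (sval p).
Proof.
by have [p SPp R] := symtab_perm (symtab_PTB (svalP T)); exists (exist _ p SPp).
Qed.

Lemma SP_realized n (p : SP n) : exists T : PTB n, tab_realizes (sval T) (sval p).
Proof.
have [D [f [S R]]] := symtab_exists (svalP p).
exists (exist _ (tableau_of n D f) (is_PTB_of S)).
apply/realizesP => s sn /=; rewrite !(lab_ext _ _ (in_sym_of S)).
rewrite -(realizesP _ _ _ R) //; congr lab.
have -> : exit n (in_sym (tableau_of n D f)) (sym_one (tableau_of n D f)) s =
          exit n D (sym_one (tableau_of n D f)) s.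
  by case: (s) => x; apply: trav_shape_ext => r c; rewrite in_sym_of.
by apply: exit_ext => r c Drc; rewrite sym_one_of // Drc.
Qed.

Lemma tab_realizes_inj n (T T' : PTB n) (p : SP n) :
  tab_realizes (sval T) (sval p) -> tab_realizes (sval T') (sval p) -> T = T'.
Proof.
move=> R R'; apply: val_inj.
have [DD ff] := symtab_inj (symtab_PTB (svalP T)) R (symtab_PTB (svalP T')) R'.
exact: PTB_inj (svalP T) (svalP T') DD ff.
Qed.

Lemma tab_realizes_fun n (T : PTB n) (p q : SP n) :
  tab_realizes (sval T) (sval p) -> tab_realizes (sval T) (sval q) -> p = q.
Proof.
move=> /realizesP Rp /realizesP Rq; apply/val_inj/permP => i; apply/val_inj/succn_inj.
have [sn sE] := unlabP (ferrers_in_sym (svalP T)) (ltn_ord i : 0 < i.+1 <= 2 * n).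
by rewrite -!papp_ord -sE -Rp // Rq.
Qed.

Theorem theorem3p3 (n : nat) :
  exists2 Phi : PTB n -> SP n, is_PhiB Phi & bijective Phi.
Proof.
pose Phi T := xchoose (@PTB_realized n T).
pose Psi p := xchoose (@SP_realized n p).
have PhiP T : tab_realizes (sval T) (sval (Phi T)) := xchooseP (PTB_realized T).
have PsiP p : tab_realizes (sval (Psi p)) (sval p) := xchooseP (SP_realized p).
exists Phi => [T i j|]; first exact: realizes_zigzag (svalP T) (PhiP T).
exists Psi => [T|p]; first exact: tab_realizes_inj (PsiP _) (PhiP T).
exact: tab_realizes_fun (PhiP _) (PsiP p).
Qed.
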